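(* Consider formal expressions which are finite sums (with multiplicities) of finite products of factors $s_{ab}=\sin(\theta_b-\theta_a)$, $a<b$ natural numbers, where the $\theta_i$ are indeterminate angles. Formally, a product is a finite multiset of 2-element subsets of $\mathbb{N}$ and an expression is a finite multiset of products. An expansion step applies the identity $\sin(\theta_c-\theta_a)\sin(\theta_d-\theta_b)=\sin(\theta_b-\theta_a)\sin(\theta_d-\theta_c)+\sin(\theta_d-\theta_a)\sin(\theta_c-\theta_b)$ with $a<b<c<d$: one chooses a product $p$ in the expression containing (as members of the multiset) both $\{a,c\}$ and $\{b,d\}$ with $a<b<c<d$, removes one copy of $p$ from the expression, and adds the two products obtained from $p$ by replacing one copy each of $\{a,c\},\{b,d\}$ by $\{a,b\},\{c,d\}$, respectively by $\{a,d\},\{b,c\}$. Then, starting from any expression, repeated application of expansion steps always terminates, and the expression reached when no expansion step applies (the normal form) is uniquely determined by the starting expression.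
   Context: Multisets: a product may contain the same pair several times, and an expression may contain the same product several times; removal and addition are multiset operations. Each expansion step does not change the value of the expression as a function of the $\theta_i$. *)

(* Defs.v *)
From mathcomp Require Import all_boot.
From mathcomp Require Import finmap multiset.
From Stdlib Require Import Relations.

Set Implicit Arguments.
Unset Strict Implicit.
Unset Printing Implicit Defensive.

Local Open Scope fset_scope.
Local Open Scope mset_scope.

(* A factor s_{ab} is a 2-element subset {a,b} of nat.
   A product is a finite multiset of such subsets;
   an expression is a finite multiset of products. *)
Notation pair_t := {fset nat}.
Notation product := {mset {fset nat}}.
Notation expression := {mset {mset {fset nat}}}.

Definition wf_expr (E : expression) : Prop :=
  forall p : product, p \in E -> forall s, s \in p -> #|` s| = 2.

Definition expand_step (E E' : expression) : Prop :=
  exists (p : product) (a b c d : nat),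
    p \in E /\ a < b /\ b < c /\ c < d /\
    [fset a; c] \in p /\ [fset b; d] \in p /\
    E' = (E `\ p) `+`
         [mset ((p `\ [fset a; c]) `\ [fset b; d]) `+` [mset [fset a; b]; [fset c; d]];
               ((p `\ [fset a; c]) `\ [fset b; d]) `+` [mset [fset a; d]; [fset b; c]]].

Definition normal_form (E : expression) : Prop :=
  forall E', ~ expand_step E E'.

(* Main.v *)
(** Termination: the energy [\sum_p 3 ^ weight p] decreases, because writing
    x, y, z > 0 for the gaps of a < b < c < d, an expansion step either shrinks
    the total length of the chords by 2y or keeps it and increases the sum of
    the squared lengths by 2xz; both decrease the weight (total length)^2 - sum
    of squared lengths.

    Uniqueness: in a normal form all products are non-crossing.  Replacing
    [s_ab] by the Pluecker coordinate [x_a y_b - x_b y_a] yields a value that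
    expansion steps preserve.  The leading term of a product is the product of
    the [x_(lo s) y_(hi s)], and a non-crossing product is determined by the
    multisets of its left and right endpoints; so distinct non-crossing products
    have distinct leading monomials and their values are linearly independent.
    Monomials are encoded as powers of a single variable through base-[B]
    expansions with [B] large. *)

Require Import Defs.
From mathcomp Require Import all_boot.
From mathcomp Require Import finmap multiset.
From Stdlib Require Import Relations.
From Stdlib Require Wf_nat.
From mathcomp Require Import ssralg poly ssrnum ssrint zify ring.

Set Implicit Arguments.
Unset Strict Implicit.
Unset Printing Implicit Defensive.

Local Open Scope fset_scope.
Local Open Scope mset_scope.
Local Open Scope nat_scope.

(** * Sums and products over multisets *)

Lemma perm_msetD (K : choiceType) (A B : {mset K}) :
  perm_eq (A `+` B) ((A : seq K) ++ B).
Proof. by apply/allP => x _; rewrite /= count_cat !count_mem_mset msetE2. Qed.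

Lemma perm_mset1D (K : choiceType) (x : K) (A : {mset K}) :
  perm_eq (x +` A) (x :: A).
Proof. by apply: (perm_trans (perm_msetD _ _)); rewrite enum_msetn. Qed.

Lemma big_mset1D (R : Type) (idx : R) (op : Monoid.com_law idx)
    (K : choiceType) (x : K) (A : {mset K}) (F : K -> R) :
  \big[op/idx]_(y <- x +` A) F y = op (F x) (\big[op/idx]_(y <- A) F y).
Proof. by rewrite (perm_big _ (perm_mset1D x A)) big_cons. Qed.

Lemma big_mset1D2 (R : Type) (idx : R) (op : Monoid.com_law idx)
    (K : choiceType) (x y : K) (A : {mset K}) (F : K -> R) :
  \big[op/idx]_(z <- x +` (y +` A)) F z =
  op (F x) (op (F y) (\big[op/idx]_(z <- A) F z)).
Proof. by rewrite !big_mset1D. Qed.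

(** * Factors as ordered pairs of endpoints *)

Definition hi (s : {fset nat}) : nat := \max_(i <- s) i.
(** Meant for two-element sets, where removing the maximum from the sum leaves the minimum; a big
    operator for the minimum would lack a neutral element on [nat]. *)
Definition lo (s : {fset nat}) : nat := \sum_(i <- s) i - hi s.

Lemma hi_pair a b : a < b -> hi [fset a; b] = b.
Proof.
move=> ab; rewrite /hi big_fsetU1 ?inE ?ltn_eqF // big_seq_fset1.
by apply/maxn_idPr/ltnW.
Qed.

Lemma lo_pair a b : a < b -> lo [fset a; b] = a.
Proof.
move=> ab; rewrite /lo hi_pair // big_fsetU1 ?inE ?ltn_eqF // big_seq_fset1.
by rewrite addnK.
Qed.

Lemma card2P (s : {fset nat}) :
  #|` s| = 2 -> lo s < hi s /\ s = [fset lo s; hi s].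
Proof.
move=> s2; have /fset0Pn [a sa] : s != fset0 by rewrite -cardfs_eq0 s2.
have : #|` (s `\ a)%fset| == 1 by move: (cardfsD1 a s); rewrite s2 sa; lia.
case/cardfs1P => b sb; have {sa} es : s = [fset a; b] by rewrite -sb fsetD1K.
have /negPf ab : a != b by move: s2; rewrite es cardfs2; case: eqP.
have [lt_ab|lt_ba|e] := ltngtP a b.
- by rewrite es hi_pair ?lo_pair.
- by rewrite es fsetUC hi_pair ?lo_pair.
- by rewrite e eqxx in ab.
Qed.

(** Trades multiset subtraction for a common remainder [p] and untouched products [F], so that big
    operators split directly. *)
Lemma expand_stepP (E E' : expression) : expand_step E E' ->
  exists (p : product) (F : expression) (a b c d : nat),
    [/\ a < b, b < c, c < d,
      E = ([fset a; c] +` ([fset b; d] +` p)) +` F &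
      E' = ([fset a; b] +` ([fset c; d] +` p)) +`
           (([fset a; d] +` ([fset b; c] +` p)) +` F)].
Proof.
case=> p [a [b [c [d [pE [ab [bc [cd [acp [bdp ->]]]]]]]]]].
(* The two crossing factors have different maxima, so removing one leaves the other in place. *)
have bdp' : [fset b; d] \in p `\ [fset a; c].
  rewrite in_msetB1 bdp andbT; apply/implyP => /eqP e.
  have := hi_pair (ltn_trans bc cd); rewrite e hi_pair ?(ltn_trans ab) //.
  by move=> cdE; rewrite cdE ltnn in cd.
exists (p `\ [fset a; c] `\ [fset b; d]), (E `\ p), a, b, c, d.
split=> //; first by rewrite !msetB1K.
set q := _ `\ [fset b; d].
by rewrite msetDC -msetDA ![q `+` _]msetDC -!msetDA.
Qed.

Lemma expand_step_wf E E' : expand_step E E' -> wf_expr E -> wf_expr E'.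
Proof.
move=> /expand_stepP [p [F [a [b [c [d [ab bc cd -> ->]]]]]]] wf.
have wfp : forall s, s \in p -> #|` s| = 2.
  by move=> s sp; apply: (wf _ (mset1D1 _ _)); rewrite !in_mset1D sp !orbT.
have pair2 x y : x < y -> #|` [fset x; y]| = 2.
  by move=> xy; rewrite cardfs2 ltn_eqF.
have pair_wf x y z t : x < y -> z < t ->
    forall s, s \in [fset x; y] +` ([fset z; t] +` p) -> #|` s| = 2.
  by move=> xy zt s; rewrite !in_mset1D => /or3P [/eqP->|/eqP->|/wfp//]; exact: pair2.
move=> q; rewrite !in_mset1D => /or3P [/eqP->|/eqP->|qF].
- exact: pair_wf.
- by apply: pair_wf => //; lia.
- by apply: wf; rewrite in_mset1D qF orbT.
Qed.

(** * Termination *)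

Definition len (s : {fset nat}) : nat := hi s - lo s.

Lemma len_pair a b : a < b -> len [fset a; b] = b - a.
Proof. by move=> ab; rewrite /len hi_pair ?lo_pair. Qed.

(* Twice the sum of the products of the lengths of two distinct factors. *)
Definition weight (p : product) : nat :=
  (\sum_(s <- p) len s) ^ 2 - \sum_(s <- p) len s ^ 2.

(** Makes the truncated subtraction in [weight] exact. *)
Lemma sum_sqr_le (T : Type) (r : seq T) (f : T -> nat) :
  \sum_(x <- r) f x ^ 2 <= (\sum_(x <- r) f x) ^ 2.
Proof.
elim: r => [|x r IH]; first by rewrite !big_nil.
by rewrite !big_cons; nia.
Qed.

Lemma weight_pair_lt (p : product) a b c d : a < b -> b < c -> c < d ->
  weight ([fset a; b] +` ([fset c; d] +` p)) <
    weight ([fset a; c] +` ([fset b; d] +` p)) /\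
  weight ([fset a; d] +` ([fset b; c] +` p)) <
    weight ([fset a; c] +` ([fset b; d] +` p)).
Proof.
move=> ab bc cd; rewrite /weight !big_mset1D2 /=.
have [ac bd] := (ltn_trans ab bc, ltn_trans bc cd).
rewrite (len_pair ab) (len_pair bc) (len_pair cd) (len_pair ac) (len_pair bd).
rewrite (len_pair (ltn_trans ab bd)).
have := sum_sqr_le p len.
move: (\sum_(s <- p) len s) (\sum_(s <- p) len s ^ 2) => L Q.
rewrite -!mulnn => LQ {ac bd}.
(* Writing the gaps as successors builds their positivity into the polynomial inequalities. *)
have [x eb] : exists x, b = a.+1 + x by exists (b - a.+1); lia.
have [y ec] : exists y, c = b.+1 + y by exists (c - b.+1); lia.
have [z ed] : exists z, d = c.+1 + z by exists (d - c.+1); lia.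
have -> : b - a = x.+1 by lia.
have -> : c - b = y.+1 by lia.
have -> : c - a = (x + y).+2 by lia.
have -> : d - c = z.+1 by lia.
have -> : d - b = (y + z).+2 by lia.
have -> : d - a = (x + y + z).+3 by lia.
by split; nia.
Qed.

(** One product is replaced by two of smaller weight; base 3 suffices because 2 * 3^(m-1) < 3^m. *)
Definition energy (E : expression) : nat := \sum_(p <- E) 3 ^ weight p.

Lemma expand_step_energy E E' : expand_step E E' -> energy E' < energy E.
Proof.
move=> /expand_stepP [p [F [a [b [c [d [ab bc cd eE eE']]]]]]].
have [] := weight_pair_lt p ab bc cd.
have hE := etrans (congr1 energy eE) (big_mset1D _ _ _ _).
have hE' := etrans (congr1 energy eE') (big_mset1D2 _ _ _ _ _).
rewrite hE hE' /= addnA ltn_add2r {hE hE' eE eE'}.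
move: (weight _) (weight _) (weight _) => l m k km lm.
have le3 i : i < m -> 3 * 3 ^ i <= 3 ^ m by rewrite -expnS leq_exp2l.
by have := le3 _ km; have := le3 _ lm; have := expn_gt0 3 m; lia.
Qed.

Lemma expand_step_acc E : Acc (fun E2 E1 => expand_step E1 E2) E.
Proof.
apply: (Wf_nat.well_founded_lt_compat _ energy) => E2 E1 /expand_step_energy.
by move/ltP.
Qed.

(** * Linear independence of the non-crossing products *)

Lemma digits_inj B n (f g : nat -> nat) :
  (forall i, f i < B) -> (forall i, g i < B) ->
  \sum_(i < n) f i * B ^ i = \sum_(i < n) g i * B ^ i ->
  forall i, i < n -> f i = g i.
Proof.
elim: n f g => // n IH f g fB gB.
have shift (h : nat -> nat) : \sum_(i < n.+1) h i * B ^ i =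
    (\sum_(i < n) h i.+1 * B ^ i) * B + h 0.
  rewrite big_ord_recl expn0 muln1 addnC big_distrl; congr (_ + _).
  by apply: eq_bigr => i _; rewrite /= expnSr mulnA.
rewrite !shift => e.
have e0 : f 0 = g 0.
  by move/(congr1 (modn^~ B)): (e); rewrite !modnMDl !modn_small.
move: e; rewrite e0 => /addIn /eqP; rewrite eqn_pmul2r ?(leq_trans _ (fB 0)) //.
move=> /eqP e [|i] // ltin.
by apply: (IH (f \o succn) (g \o succn)) => /=.
Qed.

Lemma sum_expn_count B n (u : seq nat) : all (fun i => i < n) u ->
  \sum_(t <- u) B ^ t = \sum_(i < n) count_mem (i : nat) u * B ^ i.
Proof.
elim: u => [_|x u IH /= /andP[xn un]]; first by rewrite big_nil big1.
rewrite big_cons IH //.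
under [RHS]eq_bigr do rewrite mulnDl.
rewrite big_split /=; congr (_ + _).
rewrite (bigD1 (Ordinal xn)) //= eqxx mul1n big1 ?addn0 // => i.
by rewrite -val_eqE /= eq_sym => /negPf ->.
Qed.

(** The multiplicities of the exponents are the base-[B] digits of the sum: the size bounds exclude
    carries. *)
Lemma sum_expn_inj B (u v : seq nat) : size u < B -> size v < B ->
  \sum_(t <- u) B ^ t = \sum_(t <- v) B ^ t -> perm_eq u v.
Proof.
move=> uB vB; pose n := (\max_(t <- u ++ v) t).+1.
have lt_n x : x \in u ++ v -> x < n by
  move=> xuv; rewrite ltnS (@leq_bigmax_seq _ _ xpredT (fun t => t)).
rewrite !(@sum_expn_count B n); last 2 first.
- by apply/allP => x xv; apply: lt_n; rewrite mem_cat xv orbT.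
- by apply/allP => x xu; apply: lt_n; rewrite mem_cat xu.
move/(@digits_inj B n (fun i => count_mem i u) (fun i => count_mem i v)) => e.
apply/allP => x /lt_n xn; apply/eqP; apply: e xn => i.
- exact: leq_ltn_trans (count_size _ _) uB.
- exact: leq_ltn_trans (count_size _ _) vB.
Qed.

(** * Non-crossing products are determined by their endpoints *)

Definition noncrossing (p : product) : Prop :=
  forall s t, s \in p -> t \in p -> ~ (lo s < lo t < hi s /\ hi s < hi t).

Lemma normal_form_noncrossing N p :
  wf_expr N -> normal_form N -> p \in N -> noncrossing p.
Proof.
move=> wf nf pN s t sp tp [/andP[ab bc] cd].
have [_ es] := card2P (wf _ pN _ sp); have [_ et] := card2P (wf _ pN _ tp).
apply: (nf _); exists p, (lo s), (lo t), (hi s), (hi t).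
by rewrite -es -et.
Qed.

Lemma seq_extremum (T : eqType) (R : rel T) (r : seq T) (x : T) :
  ssrbool.total R -> ssrbool.transitive R -> x \in r ->
  exists2 y, y \in r & forall z, z \in r -> R y z.
Proof.
move=> Rt Rtr; elim: r x => // x r IH _ _.
have Rxx y : R y y by case/orP: (Rt y y).
case: r IH => [_|y r /(_ y (mem_head _ _)) [z zr Rz]].
  by exists x; rewrite ?mem_head // => z; rewrite inE => /eqP ->.
case/orP: (Rt x z) => [xz|zx].
  exists x; first exact: mem_head.
  by move=> t; rewrite inE => /orP[/eqP->|/Rz] //; apply: Rtr.
exists z; first by rewrite inE zr orbT.
by move=> t; rewrite inE => /orP[/eqP->|/Rz].
Qed.

Definition well_formed (p : product) : Prop :=
  forall s, s \in p -> #|` s| = 2.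

(* In a non-crossing product, an extremal factor is a shortest one among those
   ending at the first right endpoint. *)
Definition extremal (p : product) (s : {fset nat}) : Prop :=
  s \in p /\
  forall t, t \in p -> (hi s < hi t) || (hi s == hi t) && (lo t <= lo s).

Lemma extremal_exists (p : product) s : s \in p -> exists t, extremal p t.
Proof.
pose R u v := (hi u < hi v) || (hi u == hi v) && (lo v <= lo u).
move=> sp; have [||t tp Rt] := @seq_extremum _ R p s _ _ sp.
- by move=> u v; rewrite /R; lia.
- by move=> u v w; rewrite /R; lia.
- by exists t.
Qed.

(** The first right endpoint is the same in [p] and [q]. If [lo s < lo t], the factor [u] of [p]
    starting at [lo t] must, by extremality of [s], end after [hi s], and so it crosses [s]. *)
Lemma extremal_le p q s t : well_formed q -> noncrossing p ->
  perm_eq (map lo p) (map lo q) -> perm_eq (map hi p) (map hi q) ->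
  extremal p s -> extremal q t -> hi s <= hi t /\ (hi s = hi t -> lo t <= lo s).
Proof.
move=> wf nc pl ph [sp ext_s] [tq ext_t]; split.
  have : hi t \in map hi p by rewrite (perm_mem ph) map_f.
  by case/mapP => u up ->; have := ext_s u up; lia.
move=> e; rewrite leqNgt; apply/negP => lt_st.
have : lo t \in map lo p by rewrite (perm_mem pl) map_f.
case/mapP => u up tu; apply: (nc s u) => //.
by have [lt_t _] := card2P (wf _ tq); have := ext_s u up; lia.
Qed.

Lemma perm_map_mset1D (T : eqType) (f : {fset nat} -> T) (s : {fset nat})
    (p q : product) :
  perm_eq (map f (s +` p)) (map f (s +` q)) = perm_eq (map f p) (map f q).
Proof.
rewrite (permPl (perm_map f (perm_mset1D s p))).
by rewrite (permPr (perm_map f (perm_mset1D s q))) /= perm_cons.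
Qed.

(* Read left to right, the endpoints form a word of closing and opening
   parentheses, which can be matched in only one way. *)
Lemma noncrossing_inj (p q : product) :
  well_formed p -> well_formed q -> noncrossing p -> noncrossing q ->
  perm_eq (map lo p) (map lo q) -> perm_eq (map hi p) (map hi q) -> p = q.
Proof.
have [n] := ubnP (size p); elim: n p q => [|n IH] p q; first by rewrite ltn0.
move=> le_n wp wq np nq pl ph.
case: (mset_0Vmem p) => [p0|[s0 s0p]].
  have /eqP : size q = 0 by have := perm_size pl; rewrite !size_map p0 size_mset0.
  by rewrite size_mset_eq0 p0 => /eqP.
have [s ext_s] := extremal_exists s0p.
have : lo s0 \in map lo q by rewrite -(perm_mem pl) map_f.
case/mapP => t0 t0q _; have [t ext_t] := extremal_exists t0q.
(* Comparing in both directions identifies the two extremal factors, which are then removed from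
   both products. *)
have [hst lst] := extremal_le wq np pl ph ext_s ext_t.
have [hts lts] : hi t <= hi s /\ (hi t = hi s -> lo s <= lo t).
  by apply: (extremal_le wp nq _ _ ext_t ext_s); rewrite perm_sym.
have eh : hi s = hi t by apply/eqP; rewrite eqn_leq hst hts.
have el : lo s = lo t by apply/eqP; rewrite eqn_leq (lst eh) (lts (esym eh)).
have [[sp _] [tq _]] := (ext_s, ext_t).
have {t0 t0q t ext_t hst lst hts lts el eh tq} sq : s \in q.
  have [_ es] := card2P (wp _ sp); have [_ et] := card2P (wq _ tq).
  by rewrite es el eh -et.
move: le_n wp wq np nq pl ph; rewrite -(msetB1K sp) -(msetB1K sq).
move: (p `\ s) (q `\ s) => p' q' le_n wp wq np nq.
rewrite !perm_map_mset1D => pl ph; congr (_ `+` _); apply: IH => //.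
- by move: le_n; rewrite (perm_size (perm_mset1D _ _)).
- by move=> t tp; apply: wp; rewrite in_mset1D tp orbT.
- by move=> t tq; apply: wq; rewrite in_mset1D tq orbT.
- by move=> t u tp up; apply: np; rewrite in_mset1D ?tp ?up orbT.
- by move=> t u tq uq; apply: nq; rewrite in_mset1D ?tq ?uq orbT.
Qed.

(** * Values of products and their leading terms *)

(** Take [p] with value of largest degree. The coefficient at that degree is the multiplicity of
    [p], hence equal on both sides; cancel one copy and induct. *)
Lemma sum_monic_inj (K : choiceType) (v : K -> {poly int}) (M N : {mset K}) :
  (forall p, p \in M `+` N -> v p \is monic) ->
  {in M `+` N &, injective (fun p => size (v p))} ->
  (\sum_(p <- M) v p)%R = (\sum_(p <- N) v p)%R -> M = N.
Proof.
have [n] := ubnP (size (M `+` N)); elim: n M N => [|n IH] M N; first by rewrite ltn0.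
move=> le_n mon inj eMN.
case: (mset_0Vmem (M `+` N)) => [MN0|[p0 p0MN]].
  by apply/msetP => x; have := congr1 (fun A : {mset K} => A x) MN0;
     rewrite msetE2 mset0E => /eqP; rewrite addn_eq0 => /andP[/eqP-> /eqP->].
have [||p pMN max_p] := @seq_extremum _ (fun x y => size (v y) <= size (v x))
    (M `+` N) p0 _ _ p0MN.
- by move=> x y; apply: leq_total.
- by move=> y x z xy yz; apply: leq_trans yz xy.
have coefE (A : {mset K}) : {subset A <= M `+` N} ->
    ((\sum_(q <- A) v q)`_(size (v p)).-1 = (A p)%:R)%R.
  move=> AMN; rewrite coef_sum -count_mem_mset -sum1_count GRing.natr_sum.
  rewrite [RHS]big_mkcond /=; apply: eq_big_seq => q /AMN qMN.
  case: eqP => [->|neq_qp]; first exact/eqP/mon.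
  have lt_qp : size (v q) < size (v p).
    rewrite ltn_neqAle max_p // andbT; apply/eqP => e; apply: neq_qp.
    exact: inj.
  by rewrite nth_default // -ltnS (leq_trans lt_qp) // leqSpred.
have eMNp : M p = N p.
  apply/eqP; rewrite -(@Num.Theory.eqr_nat int) -!coefE ?eMN // => q qA.
    by rewrite in_msetD qA orbT.
  by rewrite in_msetD qA.
have [pM pN] : p \in M /\ p \in N.
  by move: pMN; rewrite in_msetD -!mset_gt0 eMNp orbb.
move: le_n mon inj eMN; rewrite -(msetB1K pM) -(msetB1K pN).
move: (M `\ p) (N `\ p) => {eMNp pM pN pMN max_p coefE} M' N' le_n mon inj.
rewrite !big_mset1D /= => /GRing.addrI eMN.
have sub : {subset M' `+` N' <= (p +` M') `+` (p +` N')}.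
  by move=> x; rewrite !in_msetD => /orP[->|->]; rewrite !orbT.
congr (_ `+` _); apply: IH => //.
- move: le_n; rewrite !(perm_size (perm_msetD _ _)) !size_cat.
  by rewrite !(perm_size (perm_mset1D _ _)) /=; lia.
- by move=> x /sub; apply: mon.
- by move=> x y /sub xMN /sub yMN; apply: inj.
Qed.

(* The Pluecker coordinate x_a y_b - x_b y_a at x_i = 'X^(B ^ (2 i)) and
   y_i = 'X^(B ^ (2 i + 1)): it satisfies the same three-term relation as the
   sines. *)
Definition factor_value (B : nat) (s : {fset nat}) : {poly int} :=
  ('X^(B ^ (2 * lo s) + B ^ (2 * hi s).+1) -
   'X^(B ^ (2 * hi s) + B ^ (2 * lo s).+1))%R.

Definition product_value (B : nat) (p : product) : {poly int} :=
  (\prod_(s <- p) factor_value B s)%R.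

Definition expr_value (B : nat) (E : expression) : {poly int} :=
  (\sum_(p <- E) product_value B p)%R.

Lemma factor_value_pair B a b : a < b -> factor_value B [fset a; b] =
  ('X^(B ^ (2 * a)) * 'X^(B ^ (2 * b).+1) -
   'X^(B ^ (2 * b)) * 'X^(B ^ (2 * a).+1))%R.
Proof. by move=> ab; rewrite /factor_value lo_pair ?hi_pair // !GRing.exprD. Qed.

Lemma product_value_pluecker B (p : product) a b c d : a < b -> b < c -> c < d ->
  (product_value B ([fset a; c] +` ([fset b; d] +` p)) =
   product_value B ([fset a; b] +` ([fset c; d] +` p)) +
   product_value B ([fset a; d] +` ([fset b; c] +` p)))%R.
Proof.
move=> ab bc cd; have [ac bd] := (ltn_trans ab bc, ltn_trans bc cd).
rewrite /product_value !big_mset1D2 /=.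
rewrite (factor_value_pair B ab) (factor_value_pair B bc) (factor_value_pair B cd).
rewrite (factor_value_pair B ac) (factor_value_pair B bd).
by rewrite (factor_value_pair B (ltn_trans ab bd)); ring.
Qed.

Lemma expand_step_value B E E' : expand_step E E' -> expr_value B E = expr_value B E'.
Proof.
move=> /expand_stepP [p [F [a [b [c [d [ab bc cd eE eE']]]]]]].
have hE := etrans (congr1 (expr_value B) eE) (big_mset1D _ _ _ _).
have hE' := etrans (congr1 (expr_value B) eE') (big_mset1D2 _ _ _ _ _).
by rewrite hE hE' /= product_value_pluecker // GRing.addrA.
Qed.

(** Positions of the base-[B] digits in the leading exponent of the value of [p]: even ones come
    from the x's, odd ones from the y's. *)
Definition exponents (p : product) : seq nat :=
  [seq 2 * lo s | s <- p] ++ [seq (2 * hi s).+1 | s <- p].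

Lemma perm_exponents p q : perm_eq (exponents p) (exponents q) ->
  perm_eq (map lo p) (map lo q) /\ perm_eq (map hi p) (map hi q).
Proof.
(* Parity tells left from right endpoints, and halving recovers the endpoint. *)
have countE b a r : count (fun t => (odd t == b) && a t./2) (exponents r) =
    count a (map (if b then hi else lo) r).
  rewrite count_cat !count_map; elim: (r : seq _) => //= s u IH.
  rewrite addnACA IH !mul2n /= !odd_double doubleK uphalf_double.
  by case: b {IH}; rewrite /= ?addn0.
move=> /permP e; split; apply/permP => a.
  by rewrite -(countE false) e countE.
by rewrite -(countE true) e countE.
Qed.

(** The first monomial dominates, since B^(2 hi + 1) >= 2 B^(2 hi) >= B^(2 hi) + B^(2 lo + 1). *)
Lemma factor_value_monic B s : 1 < B -> lo s < hi s ->
  factor_value B s \is monic /\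
  size (factor_value B s) = (B ^ (2 * lo s) + B ^ (2 * hi s).+1).+1.
Proof.
move=> B_gt1 lt_s.
have lt_exp : B ^ (2 * hi s) + B ^ (2 * lo s).+1 <
    B ^ (2 * lo s) + B ^ (2 * hi s).+1.
  have le1 : B ^ (2 * lo s).+1 <= B ^ (2 * hi s) by rewrite leq_exp2l //; lia.
  have gt0 : 0 < B ^ (2 * lo s) by rewrite expn_gt0; lia.
  have le2 : 2 * B ^ (2 * hi s) <= B ^ (2 * hi s).+1.
    by rewrite expnS leq_mul2r B_gt1 orbT.
  by lia.
have lt_size : size (- 'X^(B ^ (2 * hi s) + B ^ (2 * lo s).+1) : {poly int})%R <
    size ('X^(B ^ (2 * lo s) + B ^ (2 * hi s).+1) : {poly int})%R.
  by rewrite size_polyN !size_polyXn.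
split; last by rewrite /factor_value size_polyDl // size_polyXn.
by rewrite monicE /factor_value lead_coefDl // lead_coefXn.
Qed.

Lemma product_value_monic B p : 1 < B -> well_formed p ->
  product_value B p \is monic /\
  size (product_value B p) = (\sum_(t <- exponents p) B ^ t).+1.
Proof.
move=> B_gt1 wf; have {wf} : all (fun s => lo s < hi s) p.
  by apply/allP => s /wf /card2P [].
rewrite /product_value /exponents big_cat /= !big_map -big_split /=.
elim: (p : seq _) => [|s r IH] /= => [_|/andP[lt_s /IH [mr sr]]].
  by rewrite !big_nil monic1 size_poly1.
have [ms ss] := factor_value_monic B_gt1 lt_s.
rewrite !big_cons monicMl // size_monicM ?monic_neq0 // ss sr.
by split=> //; rewrite addSn addnS.
Qed.

(** * Uniqueness of the normal form *)

Lemma normal_form_inj (M N : expression) : wf_expr M -> wf_expr N ->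
  normal_form M -> normal_form N ->
  (forall B, expr_value B M = expr_value B N) -> M = N.
Proof.
move=> wM wN nM nN eMN.
(* [B] exceeds the number of exponents of every product involved, so no carries occur; adding 2 also
   makes [1 < B] hold by computation. *)
pose B := (\max_(p <- M `+` N) size (exponents p)).+2.
have ltB p : p \in M `+` N -> size (exponents p) < B.
  move=> pMN; rewrite ltnW // !ltnS.
  exact: (@leq_bigmax_seq _ _ xpredT (fun p => size (exponents p))).
have wf p : p \in M `+` N -> well_formed p.
  by rewrite in_msetD => /orP[/wM|/wN].
have nc p : p \in M `+` N -> noncrossing p.
  by rewrite in_msetD => /orP[]; apply: normal_form_noncrossing.
apply: (@sum_monic_inj _ (product_value B)); last exact: eMN.
  by move=> p /wf wp; have [] := @product_value_monic B p isT wp.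
move=> p q pMN qMN /=.
have [_ ->] := @product_value_monic B p isT (wf _ pMN).
have [_ ->] := @product_value_monic B q isT (wf _ qMN).
move=> [/(sum_expn_inj (ltB _ pMN) (ltB _ qMN)) /perm_exponents [pl ph]].
exact: noncrossing_inj (wf _ pMN) (wf _ qMN) (nc _ pMN) (nc _ qMN) pl ph.
Qed.

Lemma expand_steps_invariant E N :
  clos_refl_trans expression expand_step E N -> wf_expr E ->
  wf_expr N /\ forall B, expr_value B E = expr_value B N.
Proof.
elim=> {E N} [E N st wE|E wE|E F N _ IH1 _ IH2 wE].
- by split=> [|B]; [apply: expand_step_wf st wE | apply: expand_step_value].
- by [].
- have [wF eEF] := IH1 wE; have [wN eFN] := IH2 wF.
  by split=> // B; rewrite eEF.
Qed.

Theorem theoremt :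
  forall E : expression, wf_expr E ->
    (* termination: no infinite chain of expansion steps from E *)
    Acc (fun E2 E1 => expand_step E1 E2) E /\
    (* uniqueness of the normal form reached from E *)
    (forall N1 N2 : expression,
        clos_refl_trans expression expand_step E N1 -> normal_form N1 ->
        clos_refl_trans expression expand_step E N2 -> normal_form N2 ->
        N1 = N2).
Proof.
move=> E wE; split; first exact: expand_step_acc.
move=> N1 N2 /expand_steps_invariant /(_ wE) [w1 e1] nf1.
move=> /expand_steps_invariant /(_ wE) [w2 e2] nf2.
by apply: normal_form_inj => // B; rewrite -e1.
Qed.
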